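(* Let $k \ge 2$ and $t \ge 1$ be integers, let $c_1, \dots, c_{k-1}$ be positive integers, and let $b$ be a positive integer. Let $\mathcal{E}(-b)$ denote the equation \[ c_1x_1+c_2x_2+\dots+c_{k-1}x_{k-1} = x_k - b, \] and let $\mathcal{E}(0)$ denote the homogeneous equation $c_1x_1+c_2x_2+\dots+c_{k-1}x_{k-1} = x_k$. Let $s = \sum_{i=1}^{k-1} c_i - 1$. If $s \mid b$ and $\mathcal{E}(0)$ is $t$-regular, then \[ r(\mathcal{E}(-b);t) \le \left(\frac{b}{s}+1\right)\cdot R_C(t) - \frac{b}{s}, \] where $R_C(t) = r(\mathcal{E}(0);t)$.
   Context: For a positive integer $n$, $[1,n]=\{1,2,\dots,n\}$; a $t$-coloring of $[1,n]$ is a map from $[1,n]$ to a set of $t$ colors. A monochromatic (''mono'') solution to an equation in the variables $x_1,\dots,x_k$ is a $k$-tuple $(x_1,\dots,x_k)$ of elements of the interval, not necessarily distinct, that satisfies the equation and whose entries all have the same color. For a linear equation $\mathcal{E}$, the $t$-color Rado number $r(\mathcal{E};t)$ is the least positive integer $r$, if it exists, such that every $t$-coloring of $[1,r]$ admits a monochromatic solution to $\mathcal{E}$; if no such integer exists we set $r(\mathcal{E};t)=\infty$. The equation $\mathcal{E}$ is called $t$-regular if $r(\mathcal{E};t)$ exists (is finite). $s \mid b$ means $b = sq$ for some integer $q$; since $b>0$ this forces $s \ge 1$. *)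

(* Defs.v *)
From HB Require Import structures.
From mathcomp Require Import all_boot all_order all_algebra.
From mathcomp Require Import boolp constructive_ereal.

Set Implicit Arguments.
Unset Strict Implicit.
Unset Printing Implicit Defensive.

Import Order.TTheory GRing.Theory Num.Theory.

Local Open Scope ring_scope.

Definition interval (n : nat) := {x : nat | (1 <= x <= n)%N}.

Definition coloring (t n : nat) := interval n -> 'I_t.

Definition equation (k : nat) := ('I_k -> int) -> Prop.

Definition mono_solution (k : nat) (E : equation k) (t n : nat)
    (chi : coloring t n) (x : 'I_k -> interval n) : Prop :=
  E (fun i => (val (x i))%:Z) /\ (forall i j, chi (x i) = chi (x j)).

Definition forces_mono (k : nat) (E : equation k) (t n : nat) : Prop :=
  forall chi : coloring t n, exists x : 'I_k -> interval n,
    mono_solution E chi x.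

Definition rado_number (k : nat) (E : equation k) (t : nat) : \bar int :=
  match pselect (exists r : nat, (0 < r)%N && `[< forces_mono E t r >]) with
  | left exr => ((ex_minn exr)%:Z)%:E
  | right _ => +oo%E
  end.

Definition regular (k : nat) (E : equation k) (t : nat) : Prop :=
  rado_number E t \is a fin_num.

(* The m coefficients and m.+1 variables are numbered from 0: the variable
   x_k, with k = m.+1, is x ord_max. *)
Definition linear_eq (m : nat) (c : 'I_m -> int) (b : int) : equation m.+1 :=
  fun x => \sum_(i < m) c i * x (widen_ord (leqnSn m) i) = x ord_max + b.

(* Main.v *)
Require Import Defs.
From HB Require Import structures.
From mathcomp Require Import all_boot all_order all_algebra.
From mathcomp Require Import boolp constructive_ereal.
From mathcomp Require Import ring.

Set Implicit Arguments.
Unset Strict Implicit.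
Unset Printing Implicit Defensive.

Import Order.TTheory GRing.Theory Num.Theory.

Local Open Scope ring_scope.

(** Put [q = b / s]. Substituting the same affine map [x |-> (q + 1) x - q]
    into every variable turns solutions of the homogeneous equation into
    solutions of the equation with constant [- b]: the coefficients on the
    left add up to [s + 1], so the two sides are shifted by [- q (s + 1)] and
    [- q], which differ by [- q s = - b] ([linear_eq_affine]). Since [q >= 0],
    the map sends [[1, R]] into [[1, (q + 1) R - q]]. A coloring of the larger
    interval pulls back along it to a coloring of [[1, R]]; for [R] the
    homogeneous Rado number this pullback has a monochromatic solution, whose
    image is monochromatic for the original coloring ([forces_mono_map]). *)

Lemma rado_number_le (k : nat) (E : equation k) (t n : nat) :
  (0 < n)%N -> forces_mono E t n -> (rado_number E t <= n%:Z%:E)%E.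
Proof.
move=> n_gt0 En; rewrite /rado_number; case: pselect => [exr|[]].
  case: ex_minnP => r _ r_min; rewrite lee_fin lez_nat; apply: r_min.
  by rewrite n_gt0; apply/asboolP.
by exists n; rewrite n_gt0; apply/asboolP.
Qed.

Lemma regular_rado_number (k : nat) (E : equation k) (t : nat) :
  regular E t ->
  exists r : nat, [/\ (0 < r)%N, forces_mono E t r
                    & rado_number E t = (r%:Z%:E)%E].
Proof.
rewrite /regular /rado_number; case: pselect => [exr _|//].
case: ex_minnP => r /andP[r_gt0 /asboolP Er] _.
by exists r.
Qed.

(** Colorings pull back along [f] and solutions push forward, so forcing is
    inherited by the interval that [f] maps into. *)
Lemma forces_mono_map (k : nat) (E E' : equation k) (t m n : nat)
    (f : Defs.interval m -> Defs.interval n) :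
  (forall x : 'I_k -> Defs.interval m, E (fun i => (val (x i))%:Z) ->
     E' (fun i => (val (f (x i)))%:Z)) ->
  forces_mono E t m -> forces_mono E' t n.
Proof.
move=> fE Em chi; have [x [Ex mono_x]] := Em (chi \o f).
by exists (f \o x); split=> [|i j]; [exact: fE | exact: mono_x].
Qed.

(** The map [x |-> (q + 1) x - q] fixes [1] and scales by [q + 1]. The constant
    vector [1] misses the homogeneous equation by [\sum_i c i - 1], so removing
    it [q] times from a multiple of a solution leaves [- q] times that defect. *)
Lemma linear_eq_affine (m : nat) (c : 'I_m -> int) (q : int)
    (x : 'I_m.+1 -> int) :
  linear_eq c 0 x ->
  linear_eq c (- (q * (\sum_(i < m) c i - 1))) (fun i => (q + 1) * x i - q).
Proof.
rewrite /linear_eq addr0 => Ex.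
under eq_bigr do rewrite mulrBr mulrCA.
by rewrite sumrB -mulr_sumr -mulr_suml Ex; ring.
Qed.

(** The map [x |-> (q + 1) x - q] on positive naturals, split as [x] plus [q]
    times the distance from [1], so that both summands are nondecreasing. *)
Definition dilate (q x : nat) : nat := x + q * x.-1.

Lemma dilateE (q x : nat) :
  (0 < x)%N -> (dilate q x)%:Z = (q%:Z + 1) * x%:Z - q%:Z.
Proof. by case: x => // x _; rewrite /dilate /= PoszD PoszM intS; ring. Qed.

Lemma dilate_interval (q n x : nat) :
  (1 <= x <= n)%N -> (1 <= dilate q x <= dilate q n)%N.
Proof.
case/andP=> x_gt0 le_xn; rewrite /dilate ltn_addr //=.
by apply: leq_add => //; rewrite leq_mul2l -!subn1 leq_sub2r ?orbT.
Qed.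

Lemma forces_mono_affine (m t n q : nat) (c : 'I_m -> int) :
  forces_mono (linear_eq c 0) t n ->
  forces_mono (linear_eq c (- (q%:Z * (\sum_(i < m) c i - 1)))) t (dilate q n).
Proof.
pose f (x : Defs.interval n) : Defs.interval (dilate q n) :=
  exist _ (dilate q (val x)) (dilate_interval q (valP x)).
apply: (forces_mono_map (f := f)) => x /(linear_eq_affine q%:Z).
congr (linear_eq _ _ _); apply: funext => i.
by rewrite dilateE //; case/andP: (valP (x i)).
Qed.

Theorem theorem3 (k t : nat) (hk : (2 <= k)%N) (ht : (1 <= t)%N)
    (c : 'I_k.-1 -> int) (hc : forall i, 0 < c i) (b : int) (hb : 0 < b) :
  let s := \sum_(i < k.-1) c i - 1 in
  (s %| b)%Z ->
  regular (linear_eq c 0) t ->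
  let RC := fine (rado_number (linear_eq c 0) t) in
  (rado_number (linear_eq c (- b)) t
     <= (((b %/ s)%Z + 1) * RC - (b %/ s)%Z)%:E)%E.
Proof.
move=> s s_dvd_b /regular_rado_number[r [r_gt0 Er RrE]] /=.
rewrite RrE /=.
(* [k >= 2] provides a coefficient, so their sum is at least 1. *)
have s_ge0 : 0 <= s.
  have i0 : 'I_k.-1 by apply: (@Ordinal _ 0); rewrite -subn1 subn_gt0.
  rewrite subr_ge0 (bigD1 i0) //= -[1]addr0 lerD //; first exact: hc.
  by apply: sumr_ge0 => i _; apply: ltW.
have [q qE] : exists q : nat, (b %/ s)%Z = q%:Z.
  have s_gt0 : 0 < s.
    rewrite lt_def s_ge0 andbT.
    by apply: contraTneq s_dvd_b => ->; rewrite dvd0z gt_eqF.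
  by exists `|(b %/ s)%Z|%N; rewrite gez0_abs // divz_ge0 // ltW.
have bE : b = q%:Z * s by rewrite -qE divzK.
rewrite qE -dilateE // bE.
by apply: rado_number_le; [rewrite ltn_addr | exact: forces_mono_affine].
Qed.
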